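(* Let $d\in\mathbb{N}$ and let $X$ be a random vector, defined on a probability space $(\Omega,\Sigma,\mathbb{P})$ and taking values in $\mathbb{R}^d$, such that $\|X\|_2\le1$ almost surely. Then, for any $r\in\mathbb{N}$, there exists a partition of the sample space $\Omega$ into at most $2^r$ (measurable) parts such that, for the $\sigma$-algebra $\mathcal{F}$ generated by this partition, the conditional expectation $Y=\mathbb{E}[X\mid\mathcal{F}]$ satisfies $$\mathbb{E}\Big(\langle X,X'\rangle-\langle Y,Y'\rangle\Big)^2\le\frac{\pi^2}{r},$$ where $(X',Y')$ is an independent copy of $(X,Y)$.
   Context: $\mathbb{N}=\{1,2,3,\dots\}$. $\langle\cdot,\cdot\rangle$ and $\|\cdot\|_2$ are the Euclidean inner product and norm on $\mathbb{R}^d$. The independent copy is realized on the product space $(\Omega\times\Omega,\Sigma\otimes\Sigma,\mathbb{P}\otimes\mathbb{P})$: $X,Y$ depend on the first coordinate, $X(\omega,\omega')=X(\omega)$, $Y(\omega,\omega')=Y(\omega)$, and $X',Y'$ are the same functions of the second coordinate, $X'(\omega,\omega')=X(\omega')$, $Y'(\omega,\omega')=Y(\omega')$. The expectation in the conclusion is over this product space. *)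

(* Defs.v *)
From HB Require Import structures.
From mathcomp Require Import all_boot all_order all_algebra.
From mathcomp Require Import all_classical all_reals all_analysis.

Set Implicit Arguments.
Unset Strict Implicit.
Unset Printing Implicit Defensive.

Import Order.TTheory GRing.Theory Num.Theory.
Import numFieldNormedType.Exports.

Local Open Scope classical_set_scope.
Local Open Scope ring_scope.

(* R^d is the type [d.-tuple R], which the library equips with the product
   sigma-algebra (the Borel sigma-algebra of R^d).  Row vectors are avoided:
   they carry no measurable structure, and their library norm is the
   sup norm. *)

Definition dotprod (R : realType) (d : nat) (x y : d.-tuple R) : R :=
  \sum_(i < d) tnth x i * tnth y i.

Definition norm2 (R : realType) (d : nat) (x : d.-tuple R) : R :=
  Num.sqrt (dotprod x x).

(* [Y] is a version of E[X | <<s G>>], where [X] is integrable; [G] generates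
   the conditioning sigma-algebra.  The conditional expectation of a random
   vector is taken coordinatewise. *)
Definition is_cond_exp (disp : measure_display) (T : measurableType disp)
    (R : realType) (P : probability T R) (G : set (set T)) (d : nat)
    (X Y : T -> d.-tuple R) : Prop :=
  forall i : 'I_d,
    [/\ measurable_fun [set: g_sigma_algebraType G]
          (fun w : g_sigma_algebraType G => tnth (Y w) i),
        P.-integrable [set: T] (fun w => (tnth (Y w) i)%:E) &
        forall A : set T, <<s G >> A ->
          (\int[P]_(w in A) (tnth (Y w) i)%:E =
           \int[P]_(w in A) (tnth (X w) i)%:E)%E].

(* Main.v *)
(* Write K = <X, X'>.  Since <Y, Y'> is the conditional expectation of K given
   F (x) F, E(K - <Y, Y'>)^2 <= E(K - H)^2 for every function H of the two
   cells, so it suffices to encode X by r bits from which K can be estimated.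
   For r <= 9, H = 0 is good enough.  Otherwise, as in random hyperplane
   rounding, take bits s_i(X) and t_i(X'), i <= m = r/2, given by random signs
   with E s(x) t(y) = phi(<x, y>), where phi' >= c.  The inverse of phi, extended
   to a 1/c-Lipschitz function, applied to the average of the s_i(X) t_i(X')
   estimates K with mean square error at most 1/(c^2 m), and c = 12/25 makes
   this smaller than pi^2 / r.
   The signs are s(x) = sign(f(<g, x>) - b) with g Gaussian, b uniform on
   [-1, 1] and f(u) = 23/20 (sin u + sin(3u)/6), whose values lie in [-1, 1];
   then phi is computed from the characteristic function of g alone.  All the
   randomness is replaced by finite uniform averages, up to an arbitrarily small
   error, so that the signs can be fixed by averaging arguments. *)

Require Import Defs.
From HB Require Import structures.
From mathcomp Require Import all_boot all_order all_algebra.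
From mathcomp Require Import all_classical all_reals all_analysis.
From mathcomp Require Import measurable_realfun.
From mathcomp Require Import ring lra zify.

Set Implicit Arguments.
Unset Strict Implicit.
Unset Printing Implicit Defensive.

Import Order.TTheory GRing.Theory Num.Theory.
Import numFieldNormedType.Exports.

Local Open Scope classical_set_scope.
Local Open Scope ring_scope.

(** * Elementary estimates *)

Lemma nondecreasing_of_derive (R : realType) (f f' : R -> R) :
  (forall x : R, is_derive x 1 f (f' x)) -> (forall x, 0 <= f' x) ->
  forall a b, a <= b -> f a <= f b.
Proof.
move=> df f'0 a b ab.
have dif (x : R) : derivable f x 1 by case: (df x).
apply: (@ger0_derive1_ndecr _ f a b) => //.
- by move=> x _; rewrite derive1E; case: (df x) => _ ->.
- apply: continuous_subspaceT => x.
  by apply: differentiable_continuous; apply/derivable1_diffP.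
Qed.

Lemma sin_le_id (R : realType) (x : R) : 0 <= x -> sin x <= x.
Proof.
move=> x0; rewrite -subr_ge0.
have -> : 0 = (0 : R) - sin 0 by rewrite sin0 subr0.
apply: (@nondecreasing_of_derive _ (fun y => y - sin y) (fun y => 1 - cos y)) => //.
Qed.

Lemma cos_double_sin (R : realType) (x : R) : cos x = 1 - sin (x / 2) ^+ 2 *+ 2.
Proof.
have -> : cos x = cos ((x / 2) *+ 2).
  by congr cos; rewrite -mulr_natr; field.
by rewrite cos_mulr2n cos2sin2; ring.
Qed.

Lemma sqr_sin_le (R : realType) (x : R) : sin x ^+ 2 <= x ^+ 2.
Proof.
wlog x0 : x / 0 <= x.
  move=> H; have [/H//|xn] := leP 0 x.
  by have := H (- x); rewrite sinN !sqrrN; apply; lra.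
have := sin_le_id x0; have := sin_geN1 x; have := sin_le1 x.
move=> h1 h2 h3.
have [s0|s0] := leP 0 (sin x); first by rewrite ler_sqr.
have [x1|x1] := leP 1 x; first nra.
have : 0 <= sin x by apply: sin_ge0_pi; have := @pi_ge2 R; lra.
lra.
Qed.

Lemma cos_ge_quadratic (R : realType) (x : R) : 1 - x ^+ 2 / 2 <= cos x.
Proof. by rewrite cos_double_sin; have := sqr_sin_le (x / 2); nra. Qed.

Lemma sin_ge_cubic (R : realType) (x : R) : 0 <= x -> x - x ^+ 3 / 6 <= sin x.
Proof.
move=> x0; rewrite -subr_ge0.
pose f (y : R) := sin y - (y - y ^+ 3 / 6).
have -> : 0 = f 0 by rewrite /f sin0; ring.
apply: (@nondecreasing_of_derive _ f
  (fun y => cos y - (1 - y ^+ 2 / 2))) => //.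
  move=> y; apply: is_derive_eq.
  by rewrite /GRing.scale/= !mulr1; field.
by move=> y; rewrite subr_ge0 cos_ge_quadratic.
Qed.

(** Squaring the cubic bound at x / 2 would even give x^4 / 24; the coefficient 1/4 is the one that
    the Gaussian factor also satisfies. *)
Lemma cos_le_quartic (R : realType) (x : R) : `|x| <= 1 ->
  cos x <= 1 - x ^+ 2 / 2 + x ^+ 4 / 4.
Proof.
rewrite -(cos_norm x) => x1.
have -> : x ^+ 2 = `|x| ^+ 2 by rewrite -normrX ger0_norm ?sqr_ge0.
have -> : x ^+ 4 = `|x| ^+ 4.
  by rewrite -normrX ger0_norm// (exprM x 2 2) sqr_ge0.
have := normr_ge0 x; move: `|x| x1 => y y1 y0.
rewrite cos_double_sin.
have h : y / 2 - (y / 2) ^+ 3 / 6 <= sin (y / 2) by apply: sin_ge_cubic; lra.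
have h2 : 0 <= y / 2 - (y / 2) ^+ 3 / 6.
  have -> : y / 2 - (y / 2) ^+ 3 / 6 = y * (1 / 2 - y ^+ 2 / 48) by field.
  by apply: mulr_ge0 => //; nra.
have h3 : (y / 2 - (y / 2) ^+ 3 / 6) ^+ 2 <= sin (y / 2) ^+ 2.
  by rewrite ler_sqr ?nnegrE//; apply: le_trans h.
have h4 : (y / 2 - (y / 2) ^+ 3 / 6) ^+ 2
          = y ^+ 2 / 4 - y ^+ 4 / 48 + (y ^+ 3 / 48) ^+ 2 by field.
have := sqr_ge0 (y ^+ 3 / 48); have : 0 <= y ^+ 4 by rewrite exprn_ge0.
lra.
Qed.

(** Both terms lie between 1 - x^2 / 2 and 1 - x^2 / 2 + x^4 / 4. *)
Lemma cos_gaussian_diff (R : realType) (x : R) : `|x| <= 1 ->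
  `|cos x - expR (- (x ^+ 2 / 2))| <= x ^+ 4 / 4.
Proof.
move=> x1.
have lc := cos_ge_quadratic x; have uc := cos_le_quartic x1.
have le : 1 - x ^+ 2 / 2 <= expR (- (x ^+ 2 / 2)) by exact: expR_ge1Dx.
have ue : expR (- (x ^+ 2 / 2)) <= 1 - x ^+ 2 / 2 + x ^+ 4 / 4.
  have y0 : 0 <= x ^+ 2 / 2 by rewrite divr_ge0 ?sqr_ge0.
  have -> : x ^+ 4 / 4 = (x ^+ 2 / 2) ^+ 2 by field.
  move: (x ^+ 2 / 2) y0 => y y0.
  (* With e^y >= 1 + y, it suffices that (1 - y + y^2) (1 + y) = 1 + y^3 >= 1. *)
  rewrite expRN -[leLHS]mul1r ler_pdivrMr ?expR_gt0//.
  have h : 1 + y <= expR y by exact: expR_ge1Dx.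
  apply: (@le_trans _ _ ((1 - y + y ^+ 2) * (1 + y))); last first.
    by rewrite ler_wpM2l//; nra.
  have -> : (1 - y + y ^+ 2) * (1 + y) = 1 + y ^+ 3 by ring.
  by rewrite lerDl exprn_ge0.
by rewrite ler_norml; lra.
Qed.

Definition sinh (R : realType) (x : R) : R := (expR x - expR (- x)) / 2.

Lemma sinh_slope (R : realType) (a b : R) : b <= a -> a - b <= sinh a - sinh b.
Proof.
move=> ba.
suff : sinh b - b <= sinh a - a by lra.
apply: (@nondecreasing_of_derive _ (fun x => sinh x - x)
  (fun y => (expR y + expR (- y)) / 2 - 1)) => //.
  move=> y; rewrite /sinh.
  apply: is_derive_eq.
  by rewrite /GRing.scale/=; field.
by move=> y; have := expR_ge1Dx y; have := expR_ge1Dx (- y); lra.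
Qed.

(** Six squarings starting from e^(-1/64) >= 63/64, rounded down each time. The value 363/1000 is
    what the slope 12/25 of [phi] requires. *)
Lemma expRN1_lower (R : realType) : 363 / 1000 <= expR (- 1) :> R.
Proof.
have step (y l l' : R) : 0 <= l -> l' <= l ^+ 2 -> l <= expR (y / 2) ->
    l' <= expR y.
  move=> l0 ll h; apply: (le_trans ll).
  have -> : expR y = expR (y / 2) ^+ 2.
    by rewrite -expRM_natl; congr expR; field.
  by rewrite ler_sqr// ?nnegrE//; apply: (le_trans l0).
apply: (step _ (6026 / 10000)); [lra|lra|].
apply: (step _ (7763 / 10000)); [lra|lra|].
apply: (step _ (8811 / 10000)); [lra|lra|].
apply: (step _ (9387 / 10000)); [lra|lra|].
apply: (step _ (9689 / 10000)); [lra|lra|].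
apply: (step _ (63 / 64)); [lra|lra|].
by apply: le_trans (expR_ge1Dx _); lra.
Qed.

(** Half-angle formulas from cos(pi/2) = 0 bound cos(pi/8) above, while cos(pi/8) >= 1 - pi^2 / 128.
    The value 96/10 has to exceed the final error constant 625/144 (11/5 + 1/100). *)
Lemma pi_sqr_lower (R : realType) : 96 / 10 <= pi ^+ 2 :> R.
Proof.
have p2 := @pi_ge2 R; have p4 := @pihalf_lt2 R.
have cos_half (x : R) : cos x = cos (x / 2) ^+ 2 *+ 2 - 1.
  by rewrite -cos_mulr2n; congr cos; lra.
have c2 := cos_half (pi / 2); rewrite cos_pihalf in c2.
have c3 := cos_half (pi / 2 / 2).
have c4 : 0 <= cos (pi / 2 / 2 : R) by apply: cos_ge0_pihalf; lra.
have c8 : 0 <= cos (pi / 2 / 2 / 2 : R) by apply: cos_ge0_pihalf; lra.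
have := cos_ge_quadratic (pi / 2 / 2 / 2 : R).
have b4 : cos (pi / 2 / 2 : R) <= 7072 / 10000 by nra.
have b8 : cos (pi / 2 / 2 / 2 : R) <= 924 / 1000 by nra.
have -> : (pi / 2 / 2 / 2) ^+ 2 / 2 = pi ^+ 2 / 128 :> R by field.
lra.
Qed.

(** * Finite random models *)

(** Expectation over a uniform random seed. With finite seed sets, independence is a product type
    and averages pass through integrals by linearity. On an empty [U] the value is 0. *)
Definition fmean (R : realType) (U : finType) (F : U -> R) : R :=
  (\sum_u F u) / #|U|%:R.

Section Fmean.
Variable R : realType.

Lemma eq_fmean (U : finType) (F G : U -> R) : F =1 G -> fmean F = fmean G.
Proof. by move=> FG; congr (_ / _); apply: eq_bigr. Qed.

Lemma fmeanD (U : finType) (F G : U -> R) :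
  fmean (fun u => F u + G u) = fmean F + fmean G.
Proof. by rewrite /fmean big_split mulrDl. Qed.

Lemma fmeanZ (U : finType) (c : R) (F : U -> R) :
  fmean (fun u => c * F u) = c * fmean F.
Proof. by rewrite /fmean -mulr_sumr mulrA. Qed.

Lemma fmeanZr (U : finType) (c : R) (F : U -> R) :
  fmean (fun u => F u * c) = fmean F * c.
Proof. by rewrite /fmean -mulr_suml mulrAC. Qed.

Lemma fmeanB (U : finType) (F G : U -> R) :
  fmean (fun u => F u - G u) = fmean F - fmean G.
Proof. by rewrite /fmean sumrB mulrBl. Qed.

Lemma fmean_cst (U : finType) (c : R) : (0 < #|U|)%N ->
  fmean (fun _ : U => c) = c.
Proof.
move=> U0; rewrite /fmean sumr_const -[c *+ _]mulr_natr mulfK//.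
by rewrite pnatr_eq0 -lt0n.
Qed.

Lemma fmean_pair (U V : finType) (F : U * V -> R) :
  fmean F = fmean (fun u => fmean (fun v => F (u, v))).
Proof.
rewrite /fmean -mulr_suml pair_bigA/= card_prod natrM invfM.
rewrite [X in _ * X]mulrC mulrA; congr (_ * _ * _).
by apply: eq_bigr => -[].
Qed.

Lemma fmean_bool (F : bool -> R) : fmean F = (F true + F false) / 2.
Proof. by rewrite /fmean card_bool big_bool. Qed.

Lemma le_fmean (U : finType) (F G : U -> R) : (forall u, F u <= G u) ->
  fmean F <= fmean G.
Proof. by move=> FG; rewrite /fmean ler_wpM2r ?invr_ge0// ler_sum. Qed.

Lemma norm_fmean_le (U : finType) (F : U -> R) (c : R) : (0 < #|U|)%N ->
  (forall u, `|F u| <= c) -> `|fmean F| <= c.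
Proof.
move=> U0 Fc; rewrite -(fmean_cst c U0).
apply: (@le_trans _ _ (fmean (fun u => `|F u|))).
  rewrite /fmean normrM [X in _ * X]ger0_norm ?invr_ge0//.
  by apply: ler_wpM2r; [rewrite invr_ge0|exact: ler_norm_sum].
exact: le_fmean.
Qed.

Lemma exists_le_fmean (U : finType) (F : U -> R) (c : R) : (0 < #|U|)%N ->
  fmean F <= c -> exists u, F u <= c.
Proof.
move=> U0 Fc; apply: contrapT => /forallNP Fgt.
suff : c < fmean F by rewrite ltNge Fc.
rewrite -{1}(fmean_cst c U0) ltr_pM2r ?invr_gt0 ?ltr0n//.
have [u0 _] := card_gt0P U0.
apply: ltr_sum; last by move=> u _; rewrite ltNge; apply/negP/Fgt.
by apply/hasP; exists u0; rewrite ?mem_index_enum.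
Qed.

End Fmean.

Definition sgb (R : realType) (b : bool) : R := if b then 1 else -1.
Arguments sgb : simpl never.

Lemma normr_sgb (R : realType) b : `|sgb R b| = 1.
Proof. by case: b; rewrite /sgb ?normrN1 ?normr1. Qed.

(** A threshold uniform on [-1, 1] lies below f with probability (1 + f) / 2, so the resulting sign
    has mean f; the threshold is discretized here. *)
Lemma dither (R : realType) (e : R) : 0 < e ->
  exists (U : finType) (b : U -> R), (0 < #|U|)%N /\
    forall f, `|f| <= 1 -> `|fmean (fun u => sgb R (b u < f)) - f| <= e.
Proof.
move=> e0.
(* The 2^n thresholds are the midpoints of equal subintervals of [-1, 1]; each bisection halves the
   error. *)
suff H n : exists (U : finType) (b : U -> R),
    [/\ (0 < #|U|)%N, forall u, `|b u| < 1 &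
     forall f, `|f| <= 1 -> `|fmean (fun u => sgb R (b u < f)) - f| <= 2^-1 ^+ n].
  have [n ne] : exists n : nat, (2^-1 : R) ^+ n <= e.
    have [n en] : exists n : nat, e^-1 < n%:R.
      by exists (Num.bound e^-1); apply: archi_boundP; rewrite invr_ge0 ltW.
    exists n; rewrite exprVn invf_ple ?posrE// ?exprn_gt0//.
    by rewrite (le_trans (ltW en))// -natrX ler_nat ltnW// ltn_expl.
  have [U [b [U0 _ hb]]] := H n.
  by exists U, b; split => // f /hb /le_trans; apply.
elim: n => [|n [U [b [U0 b1 IH]]]].
  exists unit, (fun _ => 0); split; rewrite ?card_unit// ?normr0// => f.
  rewrite fmean_cst ?card_unit// expr0 /sgb.
  by rewrite !ler_norml; case: ltP => h /andP[? ?]; apply/andP; split; lra.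
exists (U * bool)%type, (fun p => (b p.1 + sgb R p.2) / 2).
split; first by rewrite card_prod card_bool muln_gt0 U0.
  move=> [u s]/=; move: (b1 u); rewrite !ltr_norml => /andP[? ?].
  by case: s; rewrite /sgb; apply/andP; split; lra.
move=> f; rewrite ler_norml => /andP[f1 f2].
rewrite fmean_pair exprS.
under eq_fmean do rewrite fmean_bool /=.
rewrite fmeanZr fmeanD.
(* For f >= 0 the thresholds of the lower half are all below f, and rescaling the upper half to
   [-1, 1] turns f into 2 f - 1. The other case is symmetric. *)
have [f0|f0] := leP 0 f.
- have -> : fmean (fun u => sgb R ((b u + sgb R false) / 2 < f)) = 1.
    rewrite -[RHS](fmean_cst _ U0); apply: eq_fmean => u.
    move: (b1 u); rewrite ltr_norml => /andP[? ?].
    by rewrite /sgb ifT//; lra.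
  have -> : fmean (fun u => sgb R ((b u + sgb R true) / 2 < f)) =
            fmean (fun u => sgb R (b u < 2 * f - 1)).
    by apply: eq_fmean => u; congr sgb; rewrite /sgb; apply/idP/idP; lra.
  have : `|2 * f - 1| <= 1 by rewrite ler_norml; apply/andP; split; lra.
  by move=> /IH; rewrite !ler_norml => /andP[? ?]; apply/andP; split; lra.
- have -> : fmean (fun u => sgb R ((b u + sgb R true) / 2 < f)) = -1.
    rewrite -[RHS](fmean_cst _ U0); apply: eq_fmean => u.
    move: (b1 u); rewrite ltr_norml => /andP[? ?].
    by rewrite /sgb ifF//; apply/negbTE; rewrite -leNgt; lra.
  have -> : fmean (fun u => sgb R ((b u + sgb R false) / 2 < f)) =
            fmean (fun u => sgb R (b u < 2 * f + 1)).
    by apply: eq_fmean => u; congr sgb; rewrite /sgb; apply/idP/idP; lra.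
  have : `|2 * f + 1| <= 1 by rewrite ler_norml; apply/andP; split; lra.
  by move=> /IH; rewrite !ler_norml => /andP[? ?]; apply/andP; split; lra.
Qed.

(** Each occurrence of j in [J] adds an independent sign times [t] to coordinate j, and cos(a + s) +
    cos(a - s) = 2 cos a cos s. The phase [a] is there for the induction. *)
Lemma rademacher_cos (R : realType) (I : finType) (t : R) (J : seq I) :
  exists (U : finType) (g : U -> I -> R), (0 < #|U|)%N /\
    forall (z : I -> R) (a : R),
      fmean (fun u => cos (a + \sum_i g u i * z i)) =
      cos a * \prod_(j <- J) cos (t * z j).
Proof.
elim: J => [|j J [U [g [U0 IH]]]].
  exists unit, (fun _ _ => 0); split; first by rewrite card_unit.
  move=> z a; rewrite big_nil mulr1 fmean_cst ?card_unit//.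
  by rewrite big1 ?addr0// => i _; rewrite mul0r.
exists (U * bool)%type,
  (fun p i => g p.1 i + (if i == j then sgb R p.2 * t else 0)).
split; first by rewrite card_prod card_bool muln_gt0 U0.
move=> z a.
have shift u b : \sum_i (g u i + (if i == j then sgb R b * t else 0)) * z i
    = sgb R b * t * z j + \sum_i g u i * z i.
  under eq_bigr do rewrite mulrDl.
  rewrite big_split/= addrC; congr (_ + _).
  rewrite (bigD1 j)//= eqxx big1 ?addr0// => i /negbTE ->.
  by rewrite mul0r.
rewrite fmean_pair.
under eq_fmean do rewrite fmean_bool /= !shift !addrA.
rewrite fmeanZr fmeanD !IH big_cons /sgb mulN1r mul1r mulNr cosB cosD.
by field.
Qed.

Lemma norm_prodB_le (R : realType) (I : Type) (J : seq I) (a b : I -> R) :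
  (forall i, `|a i| <= 1) -> (forall i, `|b i| <= 1) ->
  `|\prod_(j <- J) a j - \prod_(j <- J) b j| <= \sum_(j <- J) `|a j - b j|.
Proof.
move=> a1 b1.
have pb (K : seq I) : `|\prod_(j <- K) b j| <= 1.
  elim: K => [|k K IH]; first by rewrite big_nil normr1.
  by rewrite big_cons normrM -[leRHS]mulr1 ler_pM.
elim: J => [|j J IH]; first by rewrite !big_nil subrr normr0.
rewrite !big_cons.
have -> : a j * \prod_(i <- J) a i - b j * \prod_(i <- J) b i =
  (a j - b j) * \prod_(i <- J) b i +
  a j * (\prod_(i <- J) a i - \prod_(i <- J) b i) by ring.
apply: (le_trans (ler_normD _ _)); rewrite !normrM lerD//.
  by rewrite -[leRHS]mulr1 ler_wpM2l.
by rewrite -[leRHS]mul1r ler_pM.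
Qed.

(* By the product formula the characteristic function of normalized sums of
   random signs is close to that of a standard Gaussian vector. *)
Lemma gaussian_cos (R : realType) (I : finType) (M e : R) : 0 < e ->
  exists (U : finType) (g : U -> I -> R), (0 < #|U|)%N /\
    forall z : I -> R, (forall i, `|z i| <= M) ->
      `|fmean (fun u => cos (\sum_i g u i * z i)) -
        expR (- ((\sum_i z i ^+ 2) / 2))| <= e.
Proof.
move=> e0.
(* For k > C, the first term puts every z i / k into [-1, 1], the second makes the total error, at
   most #|I| M^4 / k, smaller than e, and the last gives k >= 1. *)
pose C : R := `|M| + #|I|%:R * M ^+ 4 / e + 1.
have C0 : 0 <= C.
  by rewrite !addr_ge0// divr_ge0 ?(ltW e0)// mulr_ge0// (exprM M 2 2) sqr_ge0.
have [k kC] : exists k : nat, C < k%:R.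
  by exists (Num.bound C); exact: archi_boundP.
have M4 : 0 <= #|I|%:R * M ^+ 4 / e.
  by rewrite divr_ge0 ?(ltW e0)// mulr_ge0// (exprM M 2 2) sqr_ge0.
have k1 : 1 <= k%:R :> R by rewrite /C in kC; have := normr_ge0 M; lra.
have k0 : 0 < k%:R :> R by lra.
have kM : `|M| <= k%:R by rewrite /C in kC; lra.
have kM4 : #|I|%:R * M ^+ 4 / e <= k%:R.
  by rewrite /C in kC; have := normr_ge0 M; lra.
(* The k^2 signs of size 1 / k give each coordinate variance 1. *)
pose J := [seq i | i <- enum I, _ <- iota 0 (k * k)].
have [U [g [U0 hg]]] := @rademacher_cos R I k%:R^-1 J.
exists U, g; split => // z zM.
have := hg z 0; under eq_fmean do rewrite add0r.
rewrite cos0 mul1r => ->.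
have zk i : `|k%:R^-1 * z i| <= 1.
  rewrite normrM ger0_norm ?invr_ge0 ?ler0n// mulrC ler_pdivrMr// mul1r.
  by apply: le_trans kM; apply: (le_trans (zM i)); exact: ler_norm.
have -> : expR (- ((\sum_i z i ^+ 2) / 2)) =
    \prod_(j <- J) expR (- ((k%:R^-1 * z j) ^+ 2 / 2)).
  rewrite -expR_sum /J big_allpairs_dep big_enum/=; congr expR.
  rewrite mulr_suml -sumrN; apply: eq_bigr => i _.
  rewrite big_const_seq count_predT size_iota iter_addr_0.
  rewrite -[X in _ = X]mulr_natr natrM.
  by field; lra.
apply: le_trans; first apply: norm_prodB_le.
- by move=> i; exact: cos_max.
- move=> i; rewrite ger0_norm ?expR_ge0// expR_le1.
  by rewrite oppr_le0 divr_ge0// sqr_ge0.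
apply: (@le_trans _ _ (\sum_(j <- J) (k%:R^-1 * z j) ^+ 4 / 4)).
  by apply: ler_sum => i _; exact: cos_gaussian_diff.
rewrite /J big_allpairs_dep big_enum/=.
apply: (@le_trans _ _ (\sum_(i : I) M ^+ 4 / k%:R)).
  apply: ler_sum => i _.
  rewrite big_const_seq count_predT size_iota iter_addr_0.
  rewrite -[X in X <= _]mulr_natr natrM.
  have -> : (k%:R^-1 * z i) ^+ 4 / 4 * (k%:R * k%:R) = z i ^+ 4 / k%:R / (4 * k%:R).
    by field; lra.
  have z4 : 0 <= z i ^+ 4 by rewrite (exprM _ 2 2) sqr_ge0.
  apply: (@le_trans _ _ (z i ^+ 4 / k%:R)).
    rewrite ler_pdivrMr; last by rewrite mulr_gt0.
    by rewrite ler_peMr// ?divr_ge0// ?ler0n//; lra.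
  rewrite ler_wpM2r ?invr_ge0 ?ler0n//.
  have -> : z i ^+ 4 = `|z i| ^+ 4 by rewrite -normrX ger0_norm.
  by apply: lerXn2r; rewrite ?nnegrE// (le_trans _ (zM i)).
rewrite sumr_const -[X in X <= _]mulr_natl mulrA ler_pdivrMr//.
by rewrite [leRHS]mulrC -ler_pdivrMr.
Qed.

(** * The rounding function and its Gaussian correlation *)

(* 23/20 is just below 2 / sqrt 3, the largest factor for which |harm| <= 1; the
   third harmonic is what allows a factor above 1. *)
Definition harm (R : realType) (u : R) : R :=
  23 / 20 * (sin u + sin (3 * u) / 6).

Lemma sin3 (R : realType) (u : R) : sin (3 * u) = 3 * sin u - 4 * sin u ^+ 3.
Proof.
have -> : 3 * u = u + u *+ 2 by rewrite -mulr_natl; ring.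
rewrite sinD sin_mulr2n cos_mulr2n.
have -> : cos u * (cos u * sin u *+ 2) = cos u ^+ 2 * sin u *+ 2 by ring.
by rewrite cos2sin2; ring.
Qed.

Lemma normr_harm (R : realType) (u : R) : `|harm u| <= 1.
Proof.
have harmE : harm u = 23 / 20 * (sin u * (3 / 2 - 2 / 3 * `|sin u| ^+ 2)).
  by rewrite /harm sin3 real_normK ?num_real//; field.
have := sin_max u; rewrite harmE !normrM.
move: `|sin u| (normr_ge0 (sin u)) => s s0 s1.
have s2 : s ^+ 2 <= 1 by rewrite expr_le1.
rewrite !ger0_norm; [|lra|lra|lra].
(* This is s^3 minus its tangent at 13/15, a rational point close to the maximizer sqrt 3 / 2 of the
   expression to be bounded. *)
have : 0 <= s ^+ 3 - 169 / 75 * s + 4394 / 3375.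
  rewrite (_ : _ + _ = (s - 13 / 15) ^+ 2 * (s + 26 / 15)); last by field.
  by rewrite mulr_ge0 ?sqr_ge0//; lra.
have -> : s ^+ 3 = s * s ^+ 2 by ring.
rewrite (_ : 23 / 20 * _ = 69 / 40 * s - 23 / 30 * (s * s ^+ 2)); last by field.
lra.
Qed.

(** The mean of harm <g, x> harm <g, y> for a standard Gaussian g and unit x, y with <x, y> = p: the
    means of sin(j <g, x>) sin(k <g, y>) are e^(-(j^2 + k^2) / 2) sinh(j k p). *)
Definition phi (R : realType) (p : R) : R :=
  (23 / 20) ^+ 2 * (expR (- 1) * sinh p + expR (- 5) * sinh (3 * p) / 3
                    + expR (- 9) * sinh (9 * p) / 36).

(** All three terms are nondecreasing, and the first alone has slope at least (23/20)^2 times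
    363/1000, just above 12/25. *)
Lemma phi_slope (R : realType) (a b : R) : b <= a ->
  12 / 25 * (a - b) <= phi a - phi b.
Proof.
move=> ba; have e1 := expRN1_lower R.
have e5 := expR_ge0 (- 5 : R); have e9 := expR_ge0 (- 9 : R).
have s1 := sinh_slope ba.
have s3 : 0 <= sinh (3 * a) - sinh (3 * b).
  by apply: le_trans (sinh_slope _); lra.
have s9 : 0 <= sinh (9 * a) - sinh (9 * b).
  by apply: le_trans (sinh_slope _); lra.
have -> : phi a - phi b = (23 / 20) ^+ 2 *
    (expR (- 1) * (sinh a - sinh b) + expR (- 5) * (sinh (3 * a) - sinh (3 * b)) / 3
     + expR (- 9) * (sinh (9 * a) - sinh (9 * b)) / 36) by rewrite /phi; ring.
have : 363 / 1000 * (a - b) <= expR (- 1) * (sinh a - sinh b).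
  apply: (@le_trans _ _ (expR (- 1) * (a - b))).
    by apply: ler_wpM2r; [rewrite subr_ge0|exact: e1].
  by apply: ler_wpM2l; [exact: expR_ge0|exact: s1].
move: (mulr_ge0 e5 s3) (mulr_ge0 e9 s9); clear -ba.
move: (_ * (sinh a - _)) (_ * (sinh (3 * a) - _)) (_ * (sinh (9 * a) - _)) => x y z.
by move=> y0 z0 xab; lra.
Qed.

Lemma phi_dist (R : realType) (a b : R) :
  `|a - b| <= 25 / 12 * `|phi a - phi b|.
Proof.
wlog ba : a b / b <= a.
  move=> H; have [/H//|ab] := leP b a.
  by rewrite distrC [X in _ * X]distrC; apply: H; exact: ltW.
have := phi_slope ba; have := ler_norm (phi a - phi b).
by rewrite [`|a - b|]ger0_norm ?subr_ge0//; lra.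
Qed.

(* McShane extension of the inverse of [f]. *)
Lemma lipschitz_inverse (R : realType) (f : R -> R) (C : R) : 0 <= C ->
  (forall a b, `|a - b| <= C * `|f a - f b|) ->
  exists g : R -> R, forall y a, `|g y - a| <= C * `|y - f a|.
Proof.
move=> C0 fC; pose S y := [set a - C * `|y - f a| | a in [set: R]].
have ubS y a : ubound (S y) (a + C * `|y - f a|).
  move=> _ [b _ <-]; rewrite lerBlDr -addrA -lerBlDl.
  apply: (le_trans (ler_norm _)); apply: (le_trans (fC _ _)).
  rewrite -mulrDr ler_wpM2l//.
  by have := ler_distD y (f b) (f a); rewrite [`|f b - y|]distrC [leRHS]addrC.
exists (fun y => sup (S y)) => y a.
have inS : S y (a - C * `|y - f a|) by exists a.
rewrite ler_distl; apply/andP; split.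
- by apply: ub_le_sup => //; exists (a + C * `|y - f a|).
- by apply: ge_sup => //; exists (a - C * `|y - f a|).
Qed.

(** Product-to-sum formulas leave only cosines of j u + k v, whose means are known. The factors 1
    are kept so that all eight cosines match one pattern. *)
Lemma harmM_expand (R : realType) (u v : R) : harm u * harm v =
  (23 / 20) ^+ 2 *
  ((cos (1 * u + -1 * v) - cos (1 * u + 1 * v)) / 2
   + (cos (1 * u + -3 * v) - cos (1 * u + 3 * v)) / 12
   + (cos (3 * u + -1 * v) - cos (3 * u + 1 * v)) / 12
   + (cos (3 * u + -3 * v) - cos (3 * u + 3 * v)) / 72).
Proof.
by rewrite /harm !mul1r !mulN1r !mulNr !cosB !cosD; field.
Qed.

Lemma gaussian_harm (R : realType) (I : finType) (e : R) : 0 < e ->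
  exists (U : finType) (g : U -> I -> R), (0 < #|U|)%N /\
    forall x y : I -> R, \sum_i x i ^+ 2 = 1 -> \sum_i y i ^+ 2 = 1 ->
      `|fmean (fun u => harm (\sum_i g u i * x i) * harm (\sum_i g u i * y i))
        - phi (\sum_i x i * y i)| <= e.
Proof.
move=> e0.
(* The eight coefficients of the expansion have absolute sum below 2, so an error e / 2 per cosine
   is enough. The bound 6 below covers the coordinates of j x + k y for j and k up to 3. *)
have e2 : 0 < e / 2 by lra.
have [U [g [U0 hg]]] := gaussian_cos I 6 e2.
exists U, g; split => // x y x1 y1.
set p := \sum_i x i * y i.
have coord1 (z : I -> R) : \sum_i z i ^+ 2 = 1 -> forall i, `|z i| <= 1.
  move=> z1 i; rewrite -[leRHS]normr1 -ler_sqr ?nnegrE// -!normrX expr1n normr1.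
  rewrite ger0_norm ?sqr_ge0// -z1 (bigD1 i)//= lerDl.
  by apply: sumr_ge0 => j _; exact: sqr_ge0.
(* For unit x and y, the vector j x + k y has squared length j^2 + k^2 + 2 j k p. *)
have key j k : `|j| <= 3 -> `|k| <= 3 ->
    `|fmean (fun u => cos (j * (\sum_i g u i * x i) + k * (\sum_i g u i * y i)))
      - expR (- ((j ^+ 2 + k ^+ 2) / 2 + j * k * p))| <= e / 2.
  move=> j3 k3; have := hg (fun i => j * x i + k * y i).
  rewrite (_ : \sum_i (j * x i + k * y i) ^+ 2 = j ^+ 2 + k ^+ 2 + 2 * (j * k * p)).
    rewrite (_ : (j ^+ 2 + k ^+ 2 + 2 * (j * k * p)) / 2 =
      (j ^+ 2 + k ^+ 2) / 2 + j * k * p); last by field.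
    under eq_fmean => u.
      rewrite (_ : \sum_i g u i * (j * x i + k * y i) =
        j * (\sum_i g u i * x i) + k * (\sum_i g u i * y i)); last first.
        by rewrite !mulr_sumr -big_split; apply: eq_bigr => i _ /=; ring.
      over.
    apply => i; apply: (le_trans (ler_normD _ _)); rewrite !normrM.
    have -> : 6 = 3 * 1 + 3 * 1 :> R by ring.
    by rewrite lerD// ler_pM// coord1.
  transitivity (j ^+ 2 * (\sum_i x i ^+ 2) + k ^+ 2 * (\sum_i y i ^+ 2)
                + 2 * (j * k * p)); last by rewrite x1 y1 !mulr1.
  rewrite /p !mulr_sumr -!big_split.
  by apply: eq_bigr => i _ /=; ring.
have n1 : `|1 : R| <= 3 by rewrite normr1; lra.
have n1' : `|-1 : R| <= 3 by rewrite normrN1; lra.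
have n3 : `|3 : R| <= 3 by rewrite ger0_norm; lra.
have n3' : `|-3 : R| <= 3 by rewrite normrN ger0_norm; lra.
under eq_fmean do rewrite harmM_expand.
rewrite fmeanZ !fmeanD !fmeanZr !fmeanB.
have := key _ _ n1 n1'; have := key _ _ n1 n1.
have := key _ _ n1 n3'; have := key _ _ n1 n3.
have := key _ _ n3 n1'; have := key _ _ n3 n1.
have := key _ _ n3 n3'; have := key _ _ n3 n3.
have -> : - ((1 ^+ 2 + (-1) ^+ 2) / 2 + 1 * -1 * p) = - 1 + p by field.
have -> : - ((1 ^+ 2 + 1 ^+ 2) / 2 + 1 * 1 * p) = - 1 - p by field.
have -> : - ((1 ^+ 2 + (-3) ^+ 2) / 2 + 1 * -3 * p) = - 5 + 3 * p by field.
have -> : - ((1 ^+ 2 + 3 ^+ 2) / 2 + 1 * 3 * p) = - 5 - 3 * p by field.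
have -> : - ((3 ^+ 2 + (-1) ^+ 2) / 2 + 3 * -1 * p) = - 5 + 3 * p by field.
have -> : - ((3 ^+ 2 + 1 ^+ 2) / 2 + 3 * 1 * p) = - 5 - 3 * p by field.
have -> : - ((3 ^+ 2 + (-3) ^+ 2) / 2 + 3 * -3 * p) = - 9 + 9 * p by field.
have -> : - ((3 ^+ 2 + 3 ^+ 2) / 2 + 3 * 3 * p) = - 9 - 9 * p by field.
rewrite /phi /sinh !expRD.
move: (fmean _) (fmean _) (fmean _) (fmean _)
  (fmean _) (fmean _) (fmean _) (fmean _) => m1 m2 m3 m4 m5 m6 m7 m8.
rewrite !ler_norml.
by do 8 ! [move=> /andP[? ?]]; apply/andP; split; lra.
Qed.

(** * Random measurable signs on the unit ball *)

(** The missing length goes into one of two extra coordinates, selected by [b]; opposite selections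
    for two vectors leave their inner product unchanged. *)
Definition unit_ext (R : realType) (d : nat) (b : bool) (x : d.-tuple R)
    (i : 'I_d + bool) : R :=
  match i with
  | inl j => tnth x j
  | inr c => if c == b then Num.sqrt (1 - dotprod x x) else 0
  end.

Lemma ext_sqr (R : realType) d b (x : d.-tuple R) : norm2 x <= 1 ->
  \sum_i unit_ext b x i ^+ 2 = 1.
Proof.
rewrite /norm2 -[X in _ <= X]sqrtr1 ler_sqrt// => x1.
rewrite big_sumType/= big_bool/=.
have -> : \sum_(i < d) tnth x i ^+ 2 = dotprod x x by [].
by case: b; rewrite /= sqr_sqrtr ?subr_ge0//; ring.
Qed.

Lemma ext_dot (R : realType) d (x y : d.-tuple R) :
  \sum_i unit_ext true x i * unit_ext false y i = dotprod x y.
Proof. by rewrite big_sumType/= big_bool/= mulr0 mul0r !addr0. Qed.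

Lemma measurable_sqrt (R : realType) : measurable_fun setT (@Num.sqrt R).
Proof. by apply: continuous_measurable_fun; exact: sqrt_continuous. Qed.

Lemma measurable_dotprod_self (R : realType) d :
  measurable_fun [set: d.-tuple R] (fun x => dotprod x x).
Proof.
apply: measurable_sum => j.
by apply: measurable_funM; exact: measurable_tnth.
Qed.

Lemma measurable_ext (R : realType) d b i :
  measurable_fun [set: d.-tuple R] (fun x => unit_ext b x i).
Proof.
case: i => [j|c]/=; first exact: measurable_tnth.
case: eqP => _; last exact: measurable_cst.
apply: (measurableT_comp (@measurable_sqrt R)).
by apply: measurable_funB => //; exact: measurable_dotprod_self.
Qed.

Lemma measurable_harm (R : realType) : measurable_fun setT (@harm R).
Proof.
have ms : measurable_fun setT (@sin R).
  by apply: continuous_measurable_fun; exact: continuous_sin.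
apply: measurable_funM => //; apply: measurable_funD => //.
apply: measurable_funM => //; exact: measurableT_comp.
Qed.

(* Rounding [harm] with two independent dithers makes the mean of the product of
   signs equal, up to [e], to the Gaussian mean [phi <x, y>]; orthogonal
   extra coordinates make both arguments unit vectors without changing the
   inner product. *)
Lemma random_signs (R : realType) (d : nat) (e : R) : 0 < e ->
  exists (U : finType) (s t : U -> d.-tuple R -> bool),
    [/\ (0 < #|U|)%N, forall u, measurable_fun setT (s u),
       forall u, measurable_fun setT (t u) &
       forall x y, norm2 x <= 1 -> norm2 y <= 1 ->
       `|fmean (fun u => sgb R (s u x) * sgb R (t u y)) - phi (dotprod x y)| <= e].
Proof.
move=> e0; have e3 : 0 < e / 3 by lra.
have [G [g [G0 hg]]] := gaussian_harm ('I_d + bool)%type e3.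
have [B [b [B0 hb]]] := dither e3.
pose h (c : bool) u (x : d.-tuple R) := harm (\sum_i g u i * unit_ext c x i).
have mh c u : measurable_fun setT (h c u).
  apply: measurableT_comp; first exact: measurable_harm.
  apply: measurable_sum => i; apply: measurable_funM => //.
  exact: measurable_ext.
exists (G * (B * B))%type, (fun u x => b u.2.1 < h true u.1 x),
  (fun u x => b u.2.2 < h false u.1 x).
split.
- by rewrite !card_prod !muln_gt0 G0 B0.
- by move=> u; exact: measurable_fun_ltr.
- by move=> u; exact: measurable_fun_ltr.
move=> x y x1 y1.
have := hg _ _ (ext_sqr true x1) (ext_sqr false y1); rewrite ext_dot => hxy.
(* For a fixed Gaussian seed the two dithers are independent, so the mean of the product of signs
   factors. *)
rewrite fmean_pair.
under eq_fmean do rewrite fmean_pair /=.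
under eq_fmean do under eq_fmean do rewrite fmeanZ.
under eq_fmean do rewrite fmeanZr.
set D := fun c u z => fmean (fun v => sgb R (b v < h c u z)).
have D1 c u z : `|D c u z| <= 1.
  by apply: norm_fmean_le => // v; rewrite normr_sgb.
have Dh c u z : `|D c u z - h c u z| <= e / 3 by apply: hb; exact: normr_harm.
have : `|fmean (fun u => D true u x * D false u y - h true u x * h false u y)|
    <= e / 3 + e / 3.
  apply: norm_fmean_le => // u.
  rewrite (_ : _ - _ = D true u x * (D false u y - h false u y)
    + (D true u x - h true u x) * h false u y); last by ring.
  apply: (le_trans (ler_normD _ _)); apply: lerD; rewrite normrM.
    by rewrite -[leRHS]mul1r ler_pM ?D1 ?Dh.
  by rewrite -[leRHS]mulr1 ler_pM ?Dh ?normr_harm.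
rewrite fmeanB; move: hxy; rewrite -/(h true _ x) -/(h false _ y).
rewrite !ler_norml.
by move=> /andP[? ?] /andP[? ?]; apply/andP; split; lra.
Qed.

(** * Bounded measurable functions *)

(** Stable under sums and products and integrable for every probability, so linearity of the
    integral applies freely. *)
Definition bounded_measurable (R : realType) d (T : measurableType d)
    (f : T -> R) : Prop :=
  measurable_fun setT f /\ exists M, forall x, `|f x| <= M.

Section BoundedMeasurable.
Context (R : realType) d (T : measurableType d).
Implicit Types f g : T -> R.
Local Notation bm := (@bounded_measurable R d T).

Lemma bm_cst c : bm (fun=> c).
Proof. by split; [exact: measurable_cst|exists `|c|]. Qed.

Lemma bmD f g : bm f -> bm g -> bm (fun x => f x + g x).
Proof.
move=> [mf [M fM]] [mg [N gN]]; split; first exact: measurable_funD.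
by exists (M + N) => x; rewrite (le_trans (ler_normD _ _))// lerD.
Qed.

Lemma bmM f g : bm f -> bm g -> bm (fun x => f x * g x).
Proof.
move=> [mf [M fM]] [mg [N gN]]; split; first exact: measurable_funM.
by exists (M * N) => x; rewrite normrM ler_pM.
Qed.

Lemma bmB f g : bm f -> bm g -> bm (fun x => f x - g x).
Proof.
move=> [mf [M fM]] [mg [N gN]]; split; first exact: measurable_funB.
by exists (M + N) => x; rewrite (le_trans (ler_normB _ _))// lerD.
Qed.

Lemma bmX f n : bm f -> bm (fun x => f x ^+ n).
Proof.
move=> bf; elim: n => [|n IH]; first exact: bm_cst.
by under [X in bm X]eq_fun do rewrite exprS; exact: bmM.
Qed.

Lemma bm_sum (I : Type) (s : seq I) (F : I -> T -> R) :
  (forall i, bm (F i)) -> bm (fun x => \sum_(i <- s) F i x).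
Proof.
move=> bF; elim: s => [|i s IH].
  by under [X in bm X]eq_fun do rewrite big_nil; exact: bm_cst.
by under [X in bm X]eq_fun do rewrite big_cons; exact: bmD.
Qed.

Lemma bm_fmean (U : finType) (F : U -> T -> R) :
  (forall i, bm (F i)) -> bm (fun x => fmean (F^~ x)).
Proof. by move=> bF; apply: bmM; [exact: bm_sum|exact: bm_cst]. Qed.

Lemma bm_bool (p : T -> bool) (c c' : R) :
  measurable_fun setT p -> bm (fun x => if p x then c else c').
Proof.
move=> mp; split; first by apply: measurable_fun_ifT.
exists (`|c| + `|c'|) => x; case: ifP => _.
  by rewrite lerDl.
by rewrite lerDr.
Qed.

Variable P : probability T R.

Lemma bm_integrable f : bm f -> P.-integrable setT (EFin \o f).
Proof.
move=> [mf [M fM]]; apply: measurable_bounded_integrable => //.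
  by rewrite ltey_eq fin_num_measure.
exists M; split; first exact: num_real.
by move=> N MN x _; exact: le_trans (fM x) (ltW MN).
Qed.

Lemma bm_RintegralD f g : bm f -> bm g ->
  (\int[P]_x (f x + g x) = \int[P]_x f x + \int[P]_x g x)%R.
Proof. by move=> bf bg; rewrite RintegralD//; exact: bm_integrable. Qed.

Lemma bm_RintegralB f g : bm f -> bm g ->
  (\int[P]_x (f x - g x) = \int[P]_x f x - \int[P]_x g x)%R.
Proof. by move=> bf bg; rewrite RintegralB//; exact: bm_integrable. Qed.

Lemma bm_RintegralZl c f : bm f ->
  (\int[P]_x (c * f x) = c * \int[P]_x f x)%R.
Proof. by move=> bf; rewrite RintegralZl//; exact: bm_integrable. Qed.

Lemma bm_le_Rintegral f g : bm f -> bm g -> (forall x, f x <= g x) ->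
  (\int[P]_x f x <= \int[P]_x g x)%R.
Proof. by move=> bf bg fg; apply: le_Rintegral => //; exact: bm_integrable. Qed.

Lemma prob_Rintegral_cst (c : R) : (\int[P]_x c = c)%R.
Proof. by rewrite Rintegral_cst// [X in fine X](probability_setT P) mulr1.
 Qed.

Lemma bm_Rintegral_sum (I : Type) (s : seq I) (F : I -> T -> R) :
  (forall i, bm (F i)) ->
  (\int[P]_x (\sum_(i <- s) F i x) = \sum_(i <- s) \int[P]_x F i x)%R.
Proof.
move=> bF; elim: s => [|i s IH].
  under eq_Rintegral do rewrite big_nil.
  by rewrite prob_Rintegral_cst big_nil.
under eq_Rintegral do rewrite big_cons.
by rewrite bm_RintegralD ?IH ?big_cons//; exact: bm_sum.
Qed.

Lemma bm_Rintegral_fmean (U : finType) (F : U -> T -> R) :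
  (forall i, bm (F i)) ->
  (\int[P]_x (fmean (F^~ x)) = fmean (fun u => \int[P]_x F u x))%R.
Proof.
move=> bF; rewrite /fmean.
under eq_Rintegral do rewrite mulrC.
rewrite bm_RintegralZl; last exact: bm_sum.
by rewrite bm_Rintegral_sum// mulrC.
Qed.

(* Derandomized Monte Carlo: choosing the samples one at a time, the cross term
   has zero mean over the next sample, so some choice adds at most 1. *)
Lemma greedy_sampling (U : finType) (a : U -> T -> R) : (0 < #|U|)%N ->
  (forall u, measurable_fun setT (a u)) -> (forall u x, `|a u x| <= 1) ->
  forall m, exists us : m.-tuple U,
    (\int[P]_x (\sum_(u <- us) (a u x - fmean (a^~ x))) ^+ 2 <= m%:R)%R.
Proof.
move=> U0 ma a1.
have ba u : bm (a u) by split => //; exists 1.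
pose c u x := a u x - fmean (a^~ x).
have bc u : bm (c u) by apply: bmB => //; exact: bm_fmean.
elim=> [|m [us IH]].
  exists [tuple]; under eq_Rintegral do rewrite big_nil expr0n/=.
  by rewrite prob_Rintegral_cst.
pose S x := \sum_(u <- us) c u x.
have bS : bm S by exact: bm_sum.
have bSc u : bm (fun x => (c u x + S x) ^+ 2) by apply: bmX; exact: bmD.
have : fmean (fun u => \int[P]_x ((c u x + S x) ^+ 2))%R <= m.+1%:R.
  rewrite -bm_Rintegral_fmean//.
  apply: (@le_trans _ _ (\int[P]_x (S x ^+ 2 + 1))%R).
    apply: bm_le_Rintegral; [exact: bm_fmean| |].
      by apply: bmD; [exact: bmX|exact: bm_cst].
    (* Averaged over u, the square (a u x - mu + S x)^2 becomes the mean of (a u x)^2, minus mu^2,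
       plus (S x)^2. *)
    move=> x; pose mu := fmean (a^~ x).
    under eq_fmean => u.
      rewrite (_ : (c u x + S x) ^+ 2 =
        a u x ^+ 2 + a u x * (2 * (S x - mu)) + (mu ^+ 2 - 2 * mu * S x + S x ^+ 2));
        last by rewrite /c -/mu; ring.
      over.
    rewrite !fmeanD !fmean_cst// fmeanZr -/mu.
    have : fmean (fun u => a u x ^+ 2) <= 1.
      rewrite -(fmean_cst 1 U0); apply: le_fmean => u.
      by rewrite -real_normK ?num_real// expr_le1.
    have := sqr_ge0 mu; nra.
  rewrite (@bm_RintegralD (fun x => S x ^+ 2) (fun=> 1));
    [|exact: bmX|exact: bm_cst].
  by rewrite prob_Rintegral_cst -natr1 lerD2r.
move=> /(exists_le_fmean U0)[u hu]; exists [tuple of u :: us].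
by under eq_Rintegral do rewrite big_cons.
Qed.

Lemma bm_fst d' (T' : measurableType d') f : bm f ->
  bounded_measurable (fun z : T * T' => f z.1).
Proof.
move=> [mf [M fM]]; split; last by exists M.
exact: measurableT_comp.
Qed.

Lemma bm_snd d' (T' : measurableType d') f : bm f ->
  bounded_measurable (fun z : T' * T => f z.2).
Proof.
move=> [mf [M fM]]; split; last by exists M.
exact: measurableT_comp.
Qed.

End BoundedMeasurable.

Lemma Rintegral_prod (R : realType) d (T : measurableType d) (P : probability T R)
    (f g : T -> R) : bounded_measurable f -> bounded_measurable g ->
  (\int[(P \x P)%E]_z (f z.1 * g z.2) = \int[P]_x f x * \int[P]_x g x)%R.
Proof.
move=> bf bg.
have bfg : bounded_measurable (fun z : T * T => f z.1 * g z.2).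
  by apply: bmM; [exact: bm_fst|exact: bm_snd].
have ifg := bm_integrable (P \x P)%E bfg.
rewrite {1}/Rintegral -(integral12_prod_meas1 ifg)/=.
rewrite -/(Rintegral P setT _) mulrC -bm_RintegralZl//; congr fine.
apply: eq_integral => x _.
rewrite -[LHS]fineK; last first.
  apply: integrable_fin_num => //.
  apply: (bm_integrable P (f := fun y => f x * g y)).
  by apply: (bmM (f := fun=> f x)) => //; exact: bm_cst.
by congr EFin; rewrite -[LHS]/(\int[P]_y (f x * g y))%R bm_RintegralZl// mulrC.
Qed.

(** * Approximation by codes *)

Section Codes.
Context (R : realType) d (T : measurableType d) (B : finType) (beta : T -> B).
Hypothesis mbeta : forall b, measurable (beta @^-1` [set b]).

Definition fiber_ind (b : B) (w : T) : R := (beta w == b)%:R.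

Lemma bm_fiber_ind b : bounded_measurable (fiber_ind b).
Proof.
split; last first.
  by exists 1 => w; rewrite /fiber_ind; case: eqP; rewrite ?normr1 ?normr0.
rewrite (_ : fiber_ind b = \1_(beta @^-1` [set b])) //.
apply/funext => w; rewrite indicE /fiber_ind; congr ((_ : bool)%:R).
by apply/eqP/idP => [wb|/set_mem//]; exact/mem_set.
Qed.

Lemma sum_fiber_ind (f : B -> R) w : \sum_b fiber_ind b w * f b = f (beta w).
Proof.
rewrite (bigD1 (beta w))//= /fiber_ind eqxx mul1r big1 ?addr0// => b.
by rewrite eq_sym => /negbTE ->; rewrite mul0r.
Qed.

Lemma bm_code (f : B -> R) : bounded_measurable (fun w => f (beta w)).
Proof.
under [X in bounded_measurable X]eq_fun do rewrite -sum_fiber_ind.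
by apply: bm_sum => b; apply: bmM; [exact: bm_fiber_ind|exact: bm_cst].
Qed.

(** Splitting into products of indicators in one variable each gives measurability on the product
    and lets integrals factor. *)
Lemma code2E (f : B -> B -> R) (z : T * T) : f (beta z.1) (beta z.2) =
  \sum_b \sum_c fiber_ind b z.1 * fiber_ind c z.2 * f b c.
Proof.
rewrite -(sum_fiber_ind (f^~ (beta z.2))); apply: eq_bigr => b _.
rewrite -(sum_fiber_ind (f b)) mulr_sumr.
by apply: eq_bigr => c _; rewrite mulrA.
Qed.

Lemma bm_code2 (f : B -> B -> R) :
  bounded_measurable (fun z : T * T => f (beta z.1) (beta z.2)).
Proof.
under [X in bounded_measurable X]eq_fun do rewrite code2E.
do 2 (apply: bm_sum => ?); apply: bmM; last exact: bm_cst.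
by apply: bmM; [apply: bm_fst|apply: bm_snd]; exact: bm_fiber_ind.
Qed.

Lemma bm_dotprod n (X X' : T -> n.-tuple R) :
  (forall i, bounded_measurable (fun w => tnth (X w) i)) ->
  (forall i, bounded_measurable (fun w => tnth (X' w) i)) ->
  bounded_measurable (fun z : T * T => dotprod (X z.1) (X' z.2)).
Proof.
move=> bX bX'; apply: bm_sum => i.
by apply: bmM; [exact: (bm_fst _ (bX i))|exact: (bm_snd _ (bX' i))].
Qed.

(* [<Y, Y'>] is the orthogonal projection of [<X, X'>] on the functions of the
   two codes. *)
Lemma cond_exp_best_approx (P : probability T R) n (X : T -> n.-tuple R)
    (y : B -> n.-tuple R) (h : B -> B -> R) :
  (forall i, bounded_measurable (fun w => tnth (X w) i)) ->
  (forall b i, \int[P]_w (fiber_ind b w * tnth (X w) i) =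
               \int[P]_w (fiber_ind b w * tnth (y (beta w)) i))%R ->
  (\int[(P \x P)%E]_z (dotprod (X z.1) (X z.2)
                  - dotprod (y (beta z.1)) (y (beta z.2))) ^+ 2 <=
   \int[(P \x P)%E]_z (dotprod (X z.1) (X z.2)
                  - h (beta z.1) (beta z.2)) ^+ 2)%R.
Proof.
move=> bX Xy.
pose Y w := y (beta w).
have bY i : bounded_measurable (fun w => tnth (Y w) i).
  exact: (bm_code (fun b => tnth (y b) i)).
pose D (z : T * T) := dotprod (X z.1) (X z.2) - dotprod (Y z.1) (Y z.2).
have bD : bounded_measurable D by apply: bmB; exact: bm_dotprod.
(* The error of [h] is D + g, so its square is at least D^2 + 2 D g; only the cross term has to be
   shown to vanish. *)
pose g b c := dotprod (y b) (y c) - h b c.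
have bg := bm_code2 g.
have bDg : bounded_measurable (fun z => D z * g (beta z.1) (beta z.2)).
  exact: bmM.
(* For each pair of cells and each coordinate, the integrals over the product factor, and the
   factors for X and Y agree by hypothesis. *)
have cross : (\int[(P \x P)%E]_z (D z * g (beta z.1) (beta z.2)) = 0)%R.
  pose F (Z : T -> n.-tuple R) b c (i : 'I_n) (z : T * T) : R :=
    (fiber_ind b z.1 * tnth (Z z.1) i) * (fiber_ind c z.2 * tnth (Z z.2) i).
  have bF (Z : T -> n.-tuple R) b c i :
      (forall i, bounded_measurable (fun w => tnth (Z w) i)) ->
      bounded_measurable (F Z b c i).
    move=> bZ.
    have bZi e : bounded_measurable (fun w => fiber_ind e w * tnth (Z w) i).
      by apply: bmM => //; exact: bm_fiber_ind.
    by apply: bmM; [exact: (bm_fst _ (bZi b))|exact: (bm_snd _ (bZi c))].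
  have bG b c i :
      bounded_measurable (fun z => g b c * (F X b c i z - F Y b c i z)).
    by apply: bmM; [exact: bm_cst|apply: bmB; exact: bF].
  under eq_Rintegral => z _.
    rewrite (_ : D z * _ =
      \sum_b \sum_c \sum_i g b c * (F X b c i z - F Y b c i z)); last first.
      rewrite code2E mulr_sumr; apply: eq_bigr => b _.
      rewrite mulr_sumr; apply: eq_bigr => c _.
      rewrite /D /dotprod -sumrB mulr_suml; apply: eq_bigr => i _.
      by rewrite /F; ring.
    over.
  rewrite bm_Rintegral_sum; last by move=> b; do 2 (apply: bm_sum => ?); exact: bG.
  rewrite big1// => b _.
  rewrite bm_Rintegral_sum; last by move=> c; apply: bm_sum => ?; exact: bG.
  rewrite big1// => c _.
  rewrite bm_Rintegral_sum; last by move=> i; exact: bG.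
  rewrite big1// => i _.
  rewrite bm_RintegralZl; last by apply: bmB; exact: bF.
  rewrite bm_RintegralB; [|exact: bF|exact: bF].
  have FE (Z : T -> n.-tuple R) :
      (forall i, bounded_measurable (fun w => tnth (Z w) i)) ->
    (\int[(P \x P)%E]_z F Z b c i z = \int[P]_w (fiber_ind b w * tnth (Z w) i) *
                                      \int[P]_w (fiber_ind c w * tnth (Z w) i))%R.
    move=> bZ; rewrite -Rintegral_prod//; apply: bmM => //; exact: bm_fiber_ind.
  by rewrite !FE// !Xy subrr mulr0.
apply: (@le_trans _ _ (\int[(P \x P)%E]_z (D z ^+ 2
    + 2 * (D z * g (beta z.1) (beta z.2))))%R).
  rewrite bm_RintegralD; [|exact: bmX|by apply: bmM => //; exact: bm_cst].
  by rewrite bm_RintegralZl// cross mulr0 addr0.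
apply: bm_le_Rintegral.
- by apply: bmD; [exact: bmX|apply: bmM => //; exact: bm_cst].
- by apply: bmX; apply: bmB; [exact: bm_dotprod|exact: bm_code2].
- move=> z.
  have -> : dotprod (X z.1) (X z.2) - h (beta z.1) (beta z.2)
    = D z + g (beta z.1) (beta z.2) by rewrite /D /g /Y; ring.
  by have := sqr_ge0 (g (beta z.1) (beta z.2)); lra.
Qed.

End Codes.

(** Cauchy-Schwarz, from the nonnegative squared lengths of x + y and x - y. *)
Lemma normr_dotprod_le1 (R : realType) n (x y : n.-tuple R) :
  norm2 x <= 1 -> norm2 y <= 1 -> `|dotprod x y| <= 1.
Proof.
have sqr1 (z : n.-tuple R) : norm2 z <= 1 -> dotprod z z <= 1.
  by rewrite /norm2 -[X in _ <= X]sqrtr1 ler_sqrt.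
move=> /sqr1 x1 /sqr1 y1.
have h (c : R) : c ^+ 2 = 1 ->
    0 <= dotprod x x + dotprod y y + 2 * (c * dotprod x y).
  move=> c1; rewrite (_ : _ + _ = \sum_i (tnth x i + c * tnth y i) ^+ 2).
    by apply: sumr_ge0 => i _; exact: sqr_ge0.
  rewrite /dotprod !mulr_sumr -!big_split; apply: eq_bigr => i _ /=.
  by rewrite sqrrD exprMn c1; ring.
have := h 1 (expr1n _ _); have := h (- 1) (sqrr_sign _ 1).
by rewrite ler_norml; lra.
Qed.

Lemma coded_approximation (R : realType) d (T : measurableType d)
    (P : probability T R) n (X : T -> n.-tuple R) (r : nat) : (0 < r)%N ->
  measurable_fun setT X -> (forall w, norm2 (X w) <= 1) ->
  (forall i, bounded_measurable (fun w => tnth (X w) i)) ->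
  exists (B : finType) (beta : T -> B) (h : B -> B -> R),
    [/\ (#|B| <= 2 ^ r)%N, forall b, measurable (beta @^-1` [set b]) &
    (\int[(P \x P)%E]_z (dotprod (X z.1) (X z.2)
        - h (beta z.1) (beta z.2)) ^+ 2 <= pi ^+ 2 / r%:R)%R].
Proof.
move=> r0 mX X1 bX.
have bK := bm_dotprod bX bX.
have K1 (z : T * T) : `|dotprod (X z.1) (X z.2)| <= 1 by exact: normr_dotprod_le1.
have pi2 := pi_sqr_lower R.
(* For r <= 9 a single cell suffices, since <X, X'>^2 <= 1 and r < 96/10 <= pi^2. *)
have [r9|r10] := leqP r 9.
  exists unit, (fun=> tt), (fun _ _ => 0); split.
  - by rewrite card_unit expn_gt0.
  - by move=> []; rewrite (_ : _ @^-1` _ = setT)//; apply/seteqP; split.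
  apply: (@le_trans _ _ (\int[(P \x P)%E]_z 1)%R).
    apply: bm_le_Rintegral; [|exact: bm_cst|].
      by apply: bmX; apply: bmB => //; exact: bm_cst.
    by move=> z; rewrite subr0 -real_normK ?num_real// expr_le1.
  rewrite prob_Rintegral_cst ler_pdivlMr ?ltr0n// mul1r.
  have : r%:R <= 9 :> R by rewrite ler_nat.
  lra.
(* Each sample costs two bits, one from [s] and one from [t]. *)
pose m := (r./2)%N; pose rr : R := r%:R; pose mm : R := m%:R.
have rr0 : 0 < rr by rewrite ltr0n.
have m0 : (0 < m)%N by rewrite /m; lia.
have mm0 : 0 < mm by rewrite ltr0n.
(* From r <= 2 m + 1 and m >= 5, with equality at r = 11. *)
have mr : 5 * rr <= 11 * mm.
  by rewrite /rr /mm -!natrM ler_nat /m; lia.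
(* Chosen so that the bias term 5 c e below, multiplied by r, is c / 100. *)
pose e : R := (500 * rr)^-1.
have rr1 : 1 <= rr by rewrite ler1n.
have rr500 : 0 < 500 * rr by lra.
have e0 : 0 < e by rewrite invr_gt0.
have e1 : e <= 1 by rewrite invf_le1//; lra.
have [U [s [t [U0 ms mt hst]]]] := random_signs n e0.
pose a u (z : T * T) := sgb R (s u (X z.1)) * sgb R (t u (X z.2)).
have ba u : bounded_measurable (a u).
  apply: bmM.
    apply: (bm_fst _ (f := fun w => sgb R (s u (X w)))).
    by apply: bm_bool; exact: (measurableT_comp (ms u) mX).
  apply: (bm_snd _ (f := fun w => sgb R (t u (X w)))).
  by apply: bm_bool; exact: (measurableT_comp (mt u) mX).
have a1 u z : `|a u z| <= 1 by rewrite normrM !normr_sgb mulr1.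
have [us hus] := greedy_sampling (P \x P)%E U0 (fun u => (ba u).1) a1 m.
have C0 : 0 <= 25 / 12 :> R by lra.
have [g hg] := lipschitz_inverse C0 (@phi_dist R).
(* Both signs are stored because the same code serves on both sides: [h] reads the [s] bits of its
   first argument and the [t] bits of its second. *)
pose beta w := map_tuple (fun u => (s u (X w), t u (X w))) us.
pose h (p q : m.-tuple (bool * bool)) :=
  g ((\sum_(i < m) sgb R (tnth p i).1 * sgb R (tnth q i).2) / mm).
have mbeta b : measurable (beta @^-1` [set b]).
  rewrite (_ : _ @^-1` _ = \bigcap_(i in [set: 'I_m])
    ((fun w => s (tnth us i) (X w)) @^-1` [set (tnth b i).1] `&`
     (fun w => t (tnth us i) (X w)) @^-1` [set (tnth b i).2])).
    apply: fin_bigcap_measurable => [|i _]; first exact: finite_finset.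
    apply: measurableI; rewrite -[X in measurable X]setTI.
      exact: (measurableT_comp (ms _) mX).
    exact: (measurableT_comp (mt _) mX).
  apply/seteqP; split => [w /= <- i _|w hw]; first by rewrite tnth_map.
  apply: eq_from_tnth => i; have [] := hw i I.
  by rewrite tnth_map; case: (tnth b i) => ? ? /= -> ->.
exists (m.-tuple (bool * bool)), beta, h; split => //.
  rewrite card_tuple card_prod card_bool -(expnM 2 2) leq_exp2l// /m; lia.
have hE z : h (beta z.1) (beta z.2) = g ((\sum_(u <- us) a u z) / mm).
  rewrite /h big_tuple; congr (g (_ / _)); apply: eq_bigr => i _.
  by rewrite !tnth_map.
pose S z := \sum_(u <- us) (a u z - fmean (a^~ z)).
have bS : bounded_measurable S.
  by apply: bm_sum => u; apply: bmB => //; exact: bm_fmean.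
pose c : R := 625 / 144.
have c0 : 0 <= c by rewrite /c; lra.
apply: (@le_trans _ _
  (\int[(P \x P)%E]_z (c / mm ^+ 2 * S z ^+ 2 + c * (5 * e)))%R).
  apply: bm_le_Rintegral.
  - by apply: bmX; apply: bmB => //; exact: bm_code2.
  - apply: bmD; last exact: bm_cst.
    by apply: bmM; [exact: bm_cst|exact: bmX].
  move=> z; rewrite hE.
  have := hg ((\sum_(u <- us) a u z) / mm) (dotprod (X z.1) (X z.2)).
  have := hst _ _ (X1 z.1) (X1 z.2).
  have : `|S z / mm| <= 2.
    rewrite normrM [`|mm^-1|]ger0_norm ?invr_ge0 ?(ltW mm0)// ler_pdivrMr//.
    have -> : 2 * mm = \sum_(u <- us) (2 : R).
      by rewrite big_const_seq count_predT size_tuple iter_addr_0 mulr_natr.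
    apply: (le_trans (ler_norm_sum _ _ _)); apply: ler_sum => u _.
    apply: (le_trans (ler_normB _ _)).
    have : `|fmean (a^~ z)| <= 1 by exact: norm_fmean_le.
    by have := a1 u z; lra.
  have -> : (\sum_(u <- us) a u z) / mm = S z / mm + fmean (a^~ z).
    rewrite /S sumrB big_const_seq count_predT size_tuple iter_addr_0.
    by rewrite -[_ *+ m]mulr_natr -/mm; field; rewrite gt_eqF.
  have -> : c / mm ^+ 2 * S z ^+ 2 = c * (S z / mm) ^+ 2 by field; rewrite gt_eqF.
  (* A is the sampling error and D = M - phi K the bias; |A| <= 2 and |D| <= e <= 1 give (A + D)^2
     <= A^2 + 5 e. The factor c is the squared Lipschitz constant 25/12. *)
  move: (dotprod _ _) (S z / mm) (g _) => K A G.
  rewrite -/(a^~ z); move: (fmean _) => M A2 ME GK.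
  have GK2 : (K - G) ^+ 2 <= c * (A + M - phi K) ^+ 2.
    rewrite -real_normK ?num_real// -[X in _ <= _ * X]real_normK ?num_real//.
    have -> : c = (25 / 12) ^+ 2 by rewrite /c; field.
    by rewrite -exprMn lerXn2r ?nnegrE ?mulr_ge0// distrC.
  apply: (le_trans GK2); rewrite -mulrDr ler_wpM2l//.
  rewrite (_ : A + M - phi K = A + (M - phi K)); last by ring.
  move: (M - phi K) ME => D De.
  have AD : A * D <= 2 * e.
    by apply: (le_trans (ler_norm _)); rewrite normrM ler_pM.
  have DD : D ^+ 2 <= e.
    rewrite -real_normK ?num_real//.
    apply: (@le_trans _ _ (`|D| * 1)); last by rewrite mulr1.
    by rewrite expr2 ler_wpM2l// (le_trans De).
  by rewrite sqrrD -[_ *+ 2]mulr_natl; lra.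
rewrite bm_RintegralD; [|by apply: bmM; [exact: bm_cst|exact: bmX]|exact: bm_cst].
rewrite bm_RintegralZl; last exact: bmX.
rewrite prob_Rintegral_cst.
apply: (@le_trans _ _ (c / mm ^+ 2 * mm + c * (5 * e))).
  by rewrite lerD2r ler_wpM2l// mulr_ge0// invr_ge0 sqr_ge0.
rewrite ler_pdivlMr//.
have rm : rr / mm <= 11 / 5 by rewrite ler_pdivrMr//; lra.
rewrite (_ : _ * rr = c * (rr / mm) + c / 100).
  by rewrite /c; lra.
by rewrite /e; field; rewrite !gt_eqF.
Qed.

(** * Conditional expectation on the fibers of a code *)

Section Fibers.
Context (T : pointedType) (B : finType) (beta : T -> B).

(** Empty preimages are removed because the parts of a partition are nonempty. *)
Definition fibers : set (set T) :=
  [set A | A !=set0 /\ exists b, A = beta @^-1` [set b]].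

Lemma fibers_partition : partition fibers id setT.
Proof.
split => [||A []//].
- apply/seteqP; split => // w _; exists (beta @^-1` [set beta w]) => //.
  by split; [exists w|exists (beta w)].
- move=> _ _ [_ [b ->]] [_ [c ->]] [w [/= wb wc]].
  by rewrite -wb -wc.
Qed.

Lemma card_fibers n : (#|B| <= n)%N -> (fibers #<= `I_n)%card.
Proof.
move=> Bn.
apply: card_le_trans (card_image_le
  (fun k => [set w | enum_rank (beta w) = k :> nat]) `I_n).
apply: subset_card_le => A [_ [b ->]].
exists (enum_rank b : nat); first exact: leq_trans (ltn_ord _) Bn.
apply/seteqP; split => w /=; last by move=> ->.
by move=> /ord_inj/enum_rank_inj.
Qed.

(** The preimages under [beta] already form a sigma-algebra, and each is a finite union of
    fibers. *)
Lemma sigma_fibersP (A : set T) : <<s fibers >> A <-> exists S, A = beta @^-1` S.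
Proof.
split.
- move: A; apply: smallest_sub; last by move=> A [_ [b ->]]; exists [set b].
  split.
  + by exists set0; rewrite preimage_set0.
  + by move=> _ [S ->]; exists (~` S); rewrite setTD preimage_setC.
  + move=> F hF; exists (\bigcup_k [set b | exists w, F k w /\ beta w = b]).
    apply/seteqP; split => w /=.
      by move=> [k _ Fw]; exists k => //; exists w.
    move=> [k _ [w' [Fw' ww']]]; exists k => //.
    by have [S FS] := hF k; move: Fw'; rewrite FS /= ww'.
- move=> [S ->].
  rewrite (_ : _ @^-1` _ = \bigcup_(b in S) (beta @^-1` [set b])); last first.
    by apply/seteqP; split => [w /= Sw|w [b Sb /= ->]//]; exists (beta w).
  apply: (@fin_bigcup_measurable _ (g_sigma_algebraType fibers)) => [|b Sb].
    exact: finite_finset.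
  have [[w wb]|e0] := pselect (exists w, beta w = b).
    by apply: sub_sigma_algebra; split; [exists w|exists b].
  rewrite (_ : _ @^-1` _ = set0); first exact: measurable0.
  by apply/seteqP; split => // w /= wb; case: e0; exists w.
Qed.

(** A level set of Y is a preimage under [beta], so it contains every point whose code it meets.
    [v0] is the value at codes that are not attained. *)
Lemma sigma_fibers_factor (V : Type) (Y : T -> V) (v0 : V) :
  (forall v, <<s fibers >> (Y @^-1` [set v])) ->
  exists y : B -> V, Y = y \o beta.
Proof.
move=> mY.
have YE w w' : beta w = beta w' -> Y w = Y w'.
  move=> ww'; have /sigma_fibersP[S SE] := mY (Y w').
  have : (Y @^-1` [set Y w']) w' by [].
  by rewrite SE /= -ww' => Sw; have : (beta @^-1` S) w by []; rewrite -SE.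
have ey b : exists v, forall w, beta w = b -> Y w = v.
  have [[w wb]|e0] := pselect (exists w, beta w = b).
    by exists (Y w) => w' wb'; apply: YE; rewrite wb.
  by exists v0 => w wb; case: e0; exists w.
have [y hy] := choice ey.
by exists y; apply/funext => w; exact: hy.
Qed.

End Fibers.

Section ConditionalExpectation.
Context (R : realType) disp (T : measurableType disp) (P : probability T R).
Context (B : finType) (beta : T -> B).
Hypothesis mbeta : forall b, measurable (beta @^-1` [set b]).

Lemma measurable_code (S : set B) : measurable (beta @^-1` S).
Proof.
rewrite (_ : _ @^-1` _ = \bigcup_(b in S) (beta @^-1` [set b])).
  by apply: fin_bigcup_measurable => [|b _]; [exact: finite_finset|exact: mbeta].
by apply/seteqP; split => [w /= Sw|w [b Sb /= ->]//]; exists (beta w).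
Qed.

Lemma integral_code (f : T -> R) (S : set B) : bounded_measurable f ->
  (\int[P]_(w in beta @^-1` S) (f w)%:E =
   (\sum_(b | b \in S) (\int[P]_w (fiber_ind R beta b w * f w))%R)%:E)%E.
Proof.
move=> bf.
have bif b : bounded_measurable (fun w => fiber_ind R beta b w * f w).
  by apply: bmM => //; exact: bm_fiber_ind.
rewrite integral_mkcond -[LHS]fineK.
  congr EFin; rewrite big_mkcond/=.
  transitivity (\int[P]_w (\sum_b (b \in S)%:R * (fiber_ind R beta b w * f w)))%R.
    congr fine; apply: eq_integral => w _.
    under eq_bigr do rewrite mulrCA.
    rewrite sum_fiber_ind patchE.
    have -> : (w \in beta @^-1` S) = (beta w \in S).
      by apply/idP/idP => /set_mem h; exact/mem_set.
    by case: ifP => _; rewrite ?mul1r ?mul0r.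
  rewrite bm_Rintegral_sum; last by move=> b; apply: bmM => //; exact: bm_cst.
  apply: eq_bigr => b _; rewrite bm_RintegralZl//.
  by case: ifP => _; rewrite ?mul1r ?mul0r.
apply: integrable_fin_num => //.
apply/(integrable_mkcond _ (measurable_code S)).
by apply: (integrableS measurableT) => //;
  [exact: measurable_code|exact: bm_integrable].
Qed.

Lemma integral_fiber (f : T -> R) b : bounded_measurable f ->
  (\int[P]_(w in beta @^-1` [set b]) (f w)%:E =
   (\int[P]_w (fiber_ind R beta b w * f w))%R%:E)%E.
Proof.
move=> bf; rewrite integral_code//.
rewrite (bigD1 b)/=; last by rewrite inE.
by rewrite big1 ?addr0// => c /andP[/set_mem/= ->]; rewrite eqxx.
Qed.

Variables (n : nat) (X Z : T -> n.-tuple R).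
Hypothesis bZ : forall i, bounded_measurable (fun w => tnth (Z w) i).
Hypothesis XZ : forall i A, measurable A ->
  (\int[P]_(w in A) (tnth (X w) i)%:E = \int[P]_(w in A) (tnth (Z w) i)%:E)%E.

(** Measurability for a finite partition makes any version a function of the code everywhere, hence
    bounded; testing on each fiber gives the integrals. [Z] stands for a bounded version of [X]. *)
Lemma cond_exp_fibers_factor Y : is_cond_exp P (fibers beta) X Y ->
  exists2 y : B -> n.-tuple R, Y = y \o beta &
  forall b i, (\int[P]_w (fiber_ind R beta b w * tnth (Z w) i) =
               \int[P]_w (fiber_ind R beta b w * tnth (y (beta w)) i))%R.
Proof.
move=> ceY.
have [y Yy] : exists y : B -> n.-tuple R, Y = y \o beta.
  apply: (sigma_fibers_factor [tuple of nseq n 0]) => v.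
  rewrite (_ : _ @^-1` _ =
      \bigcap_(i in [set: 'I_n]) ((fun w => tnth (Y w) i) @^-1` [set tnth v i])).
    apply: (@fin_bigcap_measurable _ (g_sigma_algebraType (fibers beta)))
      => [|i _].
      exact: finite_finset.
    have [mY _ _] := ceY i; rewrite -[X in measurable X]setTI.
    by apply: mY => //; exact: measurable_set1.
  apply/seteqP; split => [w /= wv i _ /=|w hw]; first by rewrite wv.
  by apply: eq_from_tnth => i; exact: hw.
exists y => // b i.
have [_ _ /(_ (beta @^-1` [set b]))] := ceY i.
have sb : <<s fibers beta >> (beta @^-1` [set b]).
  by apply/sigma_fibersP; exists [set b].
move=> /(_ sb); rewrite XZ; last exact: measurable_code.
have by_ : bounded_measurable (fun w => tnth (y (beta w)) i).
  exact: (bm_code mbeta (fun c => tnth (y c) i)).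
by rewrite Yy /= !integral_fiber// => -[].
Qed.

Lemma cond_exp_fibers_exists : exists Y, is_cond_exp P (fibers beta) X Y.
Proof.
pose p b := (\int[P]_w fiber_ind R beta b w)%R.
(* The average of Z over the cell b; on a null cell, division by 0 gives 0. *)
pose y (b : B) :=
  [tuple (\int[P]_w (fiber_ind R beta b w * tnth (Z w) i))%R / p b | i < n].
have by_ i : bounded_measurable (fun w => tnth (y (beta w)) i).
  exact: (bm_code mbeta (fun c => tnth (y c) i)).
exists (y \o beta) => i; split.
- move=> _ V mV; rewrite setTI; apply/sigma_fibersP.
  by exists [set b | V (tnth (y b) i)].
- exact: bm_integrable.
- move=> _ /sigma_fibersP[S ->]; rewrite XZ; last exact: measurable_code.
  rewrite !integral_code//; congr EFin; apply: eq_bigr => b _.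
  have bi := bm_fiber_ind R mbeta b.
  transitivity (\int[P]_w (tnth (y b) i * fiber_ind R beta b w))%R.
    apply: eq_Rintegral => w _; rewrite mulrC /fiber_ind.
    by case: eqP => [wb|_]; [rewrite /= wb|rewrite !mulr0].
  rewrite bm_RintegralZl// -/(p b) tnth_mktuple.
  (* On a null cell the integral of Z lies between - M p b and M p b, hence vanishes too. *)
  have [p0|p0] := eqVneq (p b) 0; last by rewrite divfK.
  have [_ [M ZM]] := bZ i.
  have bc (c : R) : (\int[P]_w (c * fiber_ind R beta b w) = 0)%R.
    by rewrite bm_RintegralZl// -/(p b) p0 mulr0.
  have bcm (c : R) : bounded_measurable (fun w => c * fiber_ind R beta b w).
    by apply: bmM => //; exact: bm_cst.
  rewrite p0 mulr0; apply/eqP; rewrite eq_le; apply/andP; split.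
    rewrite -(bc (- M)); apply: bm_le_Rintegral => //; first exact: bmM.
    move=> w; rewrite [leLHS]mulrC ler_wpM2l ?ler0n//.
    by have := ZM w; rewrite ler_norml => /andP[].
  rewrite -(bc M); apply: bm_le_Rintegral => //; first exact: bmM.
  move=> w; rewrite [leRHS]mulrC ler_wpM2l ?ler0n//.
  by rewrite (le_trans (ler_norm _)).
Qed.

End ConditionalExpectation.

(** * From vectors bounded everywhere to vectors bounded almost surely *)

Theorem theorem3p1 (R : realType) (d : nat) (d_gt0 : (0 < d)%N)
    (disp : measure_display) (T : measurableType disp) (P : probability T R)
    (X : {RV P >-> d.-tuple R})
    (X_le1 : {ae P, forall w, norm2 (X w) <= 1})
    (r : nat) (r_gt0 : (0 < r)%N) :
  exists parts : set (set T),
    [/\ partition parts id [set: T],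
        parts `<=` measurable,
        (parts #<= `I_(2 ^ r))%card,
        exists Y : T -> d.-tuple R, is_cond_exp P parts X Y &
        forall Y : T -> d.-tuple R, is_cond_exp P parts X Y ->
          ('E_(P \x P)[fun z : T * T =>
              ((dotprod (X z.1) (X z.2) - dotprod (Y z.1) (Y z.2)) ^+ 2)%R]
           <= (pi ^+ 2 / r%:R)%:E)%E].
Proof.
have mX : measurable_fun setT X by exact: measurable_funPT.
have mdot : measurable_fun setT (fun w => norm2 (X w) <= 1).
  apply: measurable_fun_ler; last exact: measurable_cst.
  have mc := measurableT_comp (@measurable_sqrt R) (@measurable_dotprod_self R d).
  exact: (measurableT_comp mc mX).
(* Z has norm at most 1 everywhere and equals X almost surely, so both have the same conditional
   expectations. *)
pose Z w : d.-tuple R := if norm2 (X w) <= 1 then X w else [tuple of nseq d 0].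
have mZ : measurable_fun setT Z.
  by apply: measurable_fun_ifT => //; exact: measurable_cst.
have Z1 w : norm2 (Z w) <= 1.
  rewrite /Z; case: ifP => // _; rewrite /norm2 /dotprod big1 ?sqrtr0// => i _.
  by rewrite tnth_nseq mul0r.
have bZ i : bounded_measurable (fun w => tnth (Z w) i).
  split; first exact: (measurableT_comp (measurable_tnth i) mZ).
  exists 1 => w; have := Z1 w.
  rewrite /norm2 -[X in _ <= X]sqrtr1 ler_sqrt// /dotprod => h.
  rewrite -[leRHS]normr1 -ler_sqr ?nnegrE// -!normrX expr1n normr1.
  rewrite ger0_norm ?sqr_ge0//; apply: le_trans h.
  rewrite (bigD1 i)//= expr2 lerDl; apply: sumr_ge0 => j _.
  by rewrite -expr2 sqr_ge0.
have mXi i : measurable_fun setT (fun w => tnth (X w) i).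
  exact: (measurableT_comp (measurable_tnth i) mX).
have XZ i A : measurable A ->
    (\int[P]_(w in A) (tnth (X w) i)%:E = \int[P]_(w in A) (tnth (Z w) i)%:E)%E.
  move=> mA; apply: ae_eq_integral => //.
  - by apply/measurable_EFinP; exact: measurable_funTS.
  - by apply/measurable_EFinP; apply: measurable_funTS; exact: (bZ i).1.
  - by apply: filterS X_le1 => w w1 _; rewrite /Z w1.
have [B [beta [h [B2 mbeta hbeta]]]] := coded_approximation P r_gt0 mZ Z1 bZ.
exists (fibers beta); split.
- exact: fibers_partition.
- by move=> _ [_ [b ->]]; exact: mbeta.
- exact: card_fibers.
- exact: (cond_exp_fibers_exists mbeta bZ XZ).
move=> Y /(cond_exp_fibers_factor mbeta bZ XZ)[y -> Zy].
have by_ i : bounded_measurable (fun w => tnth (y (beta w)) i).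
  exact: (bm_code mbeta (fun b => tnth (y b) i)).
have bq := bm_dotprod by_ by_.
have bD : bounded_measurable (fun z : T * T =>
    (dotprod (Z z.1) (Z z.2) - dotprod (y (beta z.1)) (y (beta z.2))) ^+ 2).
  by apply: bmX; apply: bmB => //; exact: bm_dotprod.
rewrite unlock.
rewrite (_ : (\int[_]_w _)%E = (\int[(P \x P)%E]_z
    ((dotprod (Z z.1) (Z z.2) - dotprod (y (beta z.1)) (y (beta z.2))) ^+ 2)%:E)%E).
  rewrite -[leLHS]fineK; last first.
    by apply: integrable_fin_num => //; exact: bm_integrable bD.
  rewrite lee_fin; apply: le_trans hbeta.
  exact: (cond_exp_best_approx mbeta h bZ Zy).
apply: ae_eq_integral => //.
- apply/measurable_EFinP; apply: measurable_funX.
  apply: measurable_funB; last exact: bq.1.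
  apply: measurable_sum => i; apply: measurable_funM.
    exact: (measurableT_comp (mXi i) measurable_fst).
  exact: (measurableT_comp (mXi i) measurable_snd).
- by apply/measurable_EFinP; exact: bD.1.
have [N [mN N0 XN]] := X_le1.
have fstN : (P \x P)%E (N `*` setT) = 0%E.
  by rewrite product_measure1E// [X in (X * _)%E]N0 mul0e.
have sndN : (P \x P)%E (setT `*` N) = 0%E.
  by rewrite product_measure1E// [X in (_ * X)%E]N0 mule0.
(* Off this null set both coordinates of z have X in the unit ball, so X and Z give the same
   integrand. *)
exists (N `*` setT `|` setT `*` N); split.
- by apply: measurableU; exact: measurableX.
- apply/negligibleP; first by apply: measurableU; exact: measurableX.
  by apply: negligibleU; apply/negligibleP => //; exact: measurableX.
move=> z /= hz; apply: contrapT => /not_orP[nz1 nz2]; apply: hz => _.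
have z1 : norm2 (X z.1) <= 1 by apply: contrapT => /XN nN; apply: nz1.
have z2 : norm2 (X z.2) <= 1 by apply: contrapT => /XN nN; apply: nz2.
by rewrite /Z z1 z2.
Qed.
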